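(* Let $A\in\mathbb{R}^{n\times d}$ and $b\in\mathbb{R}^n$. Suppose that $S\in\mathbb{R}^{m\times n}$ is an $\epsilon$-subspace embedding for the augmented matrix $(A\ \ b)\in\mathbb{R}^{n\times(d+1)}$ for some $0<\epsilon<1$. Let $$SA=QR\hat V^T,\qquad R=\begin{pmatrix}R_{11}&R_{12}\\0&0\end{pmatrix}\in\mathbb{R}^{d\times d},\quad Q=(Q_1\ \ Q_2)\in\mathbb{R}^{m\times d},\quad \hat V=(V_1\ \ V_2)\in\mathbb{R}^{d\times d},$$ where $R_{11}\in\mathbb{R}^{p\times p}$ is nonsingular, $Q_1\in\mathbb{R}^{m\times p}$ and $Q_2\in\mathbb{R}^{m\times(d-p)}$ have orthonormal columns, and $\hat V$ is orthogonal with $V_1\in\mathbb{R}^{d\times p}$. Let $W=AV_1R_{11}^{-1}\in\mathbb{R}^{n\times p}$ and $y_*=\arg\min_{y\in\mathbb{R}^p}\|Wy-b\|_2$. If $y_\tau=y_*$ and $x_\tau=V_1R_{11}^{-1}y_\tau$, then $x_\tau$ is a solution of the linear least squares problem $\min_{x\in\mathbb{R}^d}\|Ax-b\|_2^2$.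
   Context: $S$ is an $\epsilon$-subspace embedding for a matrix $B\in\mathbb{R}^{n\times k}$ if $(1-\epsilon)\|Bz\|_2^2\le\|SBz\|_2^2\le(1+\epsilon)\|Bz\|_2^2$ for all $z\in\mathbb{R}^k$. The matrix $A$ may be rank deficient. The quantities above are those computed by a sketch-precondition-solve algorithm: sketch $SA$, compute the (rank-revealing) factorization, solve the preconditioned problem $\min_y\|Wy-b\|_2$ (here exactly), and return $x_\tau$. *)

(* Defs.v *)
From mathcomp Require Export all_boot all_order all_algebra.
From mathcomp Require Export reals.

Set Implicit Arguments.
Unset Strict Implicit.
Unset Printing Implicit Defensive.

Export Order.TTheory GRing.Theory Num.Theory.
Global Open Scope ring_scope.

(* The norms of mathcomp-analysis on matrices are sup norms, hence an explicit
   Euclidean norm. *)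
Definition norm2 (R : realType) (n : nat) (v : 'cV[R]_n) : R :=
  Num.sqrt (\sum_i v i 0 ^+ 2).

Definition subspace_embedding (R : realType) (m n k : nat) (eps : R)
    (S : 'M[R]_(m, n)) (B : 'M[R]_(n, k)) : Prop :=
  forall z : 'cV[R]_k,
    (1 - eps) * norm2 (B *m z) ^+ 2 <= norm2 (S *m B *m z) ^+ 2 /\
    norm2 (S *m B *m z) ^+ 2 <= (1 + eps) * norm2 (B *m z) ^+ 2.

Definition orthonormal_columns (R : realType) (m n : nat)
    (Q : 'M[R]_(m, n)) : Prop :=
  Q^T *m Q = 1%:M.

Definition orthogonal_matrix (R : realType) (n : nat) (Q : 'M[R]_n) : Prop :=
  Q^T *m Q = 1%:M /\ Q *m Q^T = 1%:M.

Definition is_minimizer (R : realType) (T : Type) (f : T -> R) (x : T) : Prop :=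
  forall z : T, f x <= f z.

(* Main.v *)
Require Import Defs.

(** [A] and [W] have the same column space: [S A x] equals [S W y] for
    [y = (R11 V1^T + R12 V2^T) x], and the lower embedding bound makes [S]
    injective on the column space of [A], so [A x = W y].  Minimizing
    [|A x - b|] over [x] is therefore minimizing [|W y - b|] over [y]. *)

Lemma norm2_ge0 (R : realType) (n : nat) (v : 'cV[R]_n) : 0 <= norm2 v.
Proof. exact: sqrtr_ge0. Qed.

Lemma norm2_eq0 (R : realType) (n : nat) (v : 'cV[R]_n) :
  (norm2 v == 0) = (v == 0).
Proof.
apply/idP/eqP => [|->]; last first.
  by rewrite /norm2 big1 ?sqrtr0 // => i _; rewrite mxE expr0n.
have sq_ge0 (i : 'I_n) : true -> 0 <= v i 0 ^+ 2 by rewrite sqr_ge0.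
rewrite /norm2 sqrtr_eq0 => sum_le0.
have /eqP sum_eq0 : \sum_i v i 0 ^+ 2 == 0.
  by rewrite eq_le sum_le0 sumr_ge0.
apply/matrixP => i j; rewrite ord1 mxE; apply/eqP.
by rewrite -sqrf_eq0 (psumr_eq0P sq_ge0 sum_eq0).
Qed.

(** The lower bound becomes [(1 - eps) * norm2 (B *m z) ^+ 2 <= 0], where [1 - eps] is positive. *)
Lemma subspace_embedding_inj (R : realType) (m n k : nat) (eps : R)
    (S : 'M[R]_(m, n)) (B : 'M[R]_(n, k)) (z : 'cV[R]_k) :
  eps < 1 -> subspace_embedding eps S B -> S *m B *m z = 0 -> B *m z = 0.
Proof.
move=> eps1 /(_ z)[+ _] SBz0; rewrite SBz0.
have /eqP -> : norm2 (0 : 'cV[R]_m) == 0 by rewrite norm2_eq0.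
rewrite expr0n pmulr_rle0 ?subr_gt0 // => Bz_le0.
by apply/eqP; rewrite -norm2_eq0 -sqrf_eq0 eq_le Bz_le0 sqr_ge0.
Qed.
Arguments subspace_embedding_inj {R m n k eps S B z}.

(** Padding [z] with zeros makes the columns of [C] drop out. *)
Lemma subspace_embedding_lsubmx (R : realType) (m n k l : nat) (eps : R)
    (S : 'M[R]_(m, n)) (B : 'M[R]_(n, k)) (C : 'M[R]_(n, l)) :
  subspace_embedding eps S (row_mx B C) -> subspace_embedding eps S B.
Proof.
move=> SBC z; have := SBC (col_mx z 0).
by rewrite -mulmxA mul_row_col mulmx0 addr0 mulmxA.
Qed.
Arguments subspace_embedding_lsubmx {R m n k l eps S B C}.

(* d = p + q, so that the block partitions of Rf, Q and Vhat are the library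
   block matrices *)
Theorem theorem3p2p1 (R : realType) (m n p q : nat)
    (A : 'M[R]_(n, p + q)) (b : 'cV[R]_n) (S : 'M[R]_(m, n)) (eps : R)
    (Rf Vhat : 'M[R]_(p + q)) (Q : 'M[R]_(m, p + q))
    (R11 : 'M[R]_p) (R12 : 'M[R]_(p, q))
    (Q1 : 'M[R]_(m, p)) (Q2 : 'M[R]_(m, q))
    (V1 : 'M[R]_(p + q, p)) (V2 : 'M[R]_(p + q, q))
    (W : 'M[R]_(n, p)) (ystar ytau : 'cV[R]_p) (xtau : 'cV[R]_(p + q)) :
  0 < eps -> eps < 1 ->
  subspace_embedding eps S (row_mx A b) ->
  S *m A = Q *m Rf *m Vhat^T ->
  Rf = block_mx R11 R12 0 0 ->
  Q = row_mx Q1 Q2 ->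
  Vhat = row_mx V1 V2 ->
  R11 \in unitmx ->
  orthonormal_columns Q1 ->
  orthonormal_columns Q2 ->
  orthogonal_matrix Vhat ->
  W = A *m V1 *m invmx R11 ->
  is_minimizer (fun y : 'cV[R]_p => norm2 (W *m y - b)) ystar ->
  ytau = ystar ->
  xtau = V1 *m invmx R11 *m ytau ->
  is_minimizer (fun x : 'cV[R]_(p + q) => norm2 (A *m x - b) ^+ 2) xtau.
Proof.
move=> _ eps1 SAb SA Rf_def Q_def V_def R11u _ _ [VtV _] W_def ymin -> -> x.
have [V1V1 V2V1] : V1^T *m V1 = 1%:M /\ V2^T *m V1 = 0.
  move: VtV; rewrite V_def tr_row_mx mul_col_row scalar_mx_block.
  by case/eq_block_mx.
(* The zero bottom rows of [Rf] cancel [Q2]. *)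
have SAE : S *m A = Q1 *m (R11 *m V1^T + R12 *m V2^T).
  rewrite SA Q_def Rf_def V_def tr_row_mx -mulmxA mul_block_col !mul0mx addr0.
  by rewrite mul_row_col mulmx0 addr0.
pose y := (R11 *m V1^T + R12 *m V2^T) *m x.
have AxE : A *m x = W *m y.
  (* Factoring out [A] writes [A x - W y] as [A] applied to [x - V1 R11^-1 y], so injectivity of [S]
     on the column space of [A] applies. *)
  apply/eqP; rewrite -subr_eq0 W_def -!mulmxA -mulmxBr; apply/eqP.
  apply: (subspace_embedding_inj eps1 (subspace_embedding_lsubmx SAb)).
  rewrite SAE -mulmxA mulmxBr -/y.
  (* [V1 R11^-1] is a right inverse of the top block row of [Rf Vhat^T], by orthonormality of the
     columns of [Vhat]. *)
  suff -> : (R11 *m V1^T + R12 *m V2^T) *m (V1 *m (invmx R11 *m y)) = y.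
    by rewrite subrr mulmx0.
  rewrite mulmxA mulmxDl -!mulmxA V1V1 V2V1 mulmx0 addr0 mulmx1.
  by rewrite mulKVmx.
rewrite AxE; have -> : A *m (V1 *m invmx R11 *m ystar) = W *m ystar.
  by rewrite W_def !mulmxA.
(* Squaring is monotone on nonnegative reals, so minimality of the norm carries over to its
   square. *)
by rewrite lerXn2r ?nnegrE ?norm2_ge0 //; exact: ymin.
Qed.
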